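(* Let $z,\sigma,\tau\in\mathbb{R}$ and $A(z)=I-z\,D_0+\frac{z^2}{2}\,\Delta+\sigma\,D_0\Delta+\tau\,\Delta^2$. Take $h_0=1/2$ in the inner product $(\cdot,\cdot)_H$ and consider the set of second order extrapolation conditions $\Delta\Phi_0=D_0\Delta\Phi_0=0$ (which define the ghost values $\Phi_1,\Phi_2$). Then the boundary contribution $E:=\frac12T_{-1}+\frac12T_0+\frac12S_0$ is given by $$E=\begin{pmatrix}\Phi_0\\ D\Phi_0\\ D^2\Phi_0\end{pmatrix}^T B\begin{pmatrix}\Phi_0\\ D\Phi_0\\ D^2\Phi_0\end{pmatrix},$$ $$B:=\begin{pmatrix}-z&\frac{z^2}{2}&\frac{\sigma}{2}\\ \frac{z^2}{2}&-\frac{z^3}{2}-\sigma&-\frac{z\sigma}{2}\\ \frac{\sigma}{2}&-\frac{z\sigma}{2}&\frac{2\tau}{3}+\sigma\tau+\frac{5z\sigma}{12}-\frac{z^2\tau}{2}+2\tau^2-\frac{z^2(1-z^2)}{12}\end{pmatrix}.$$ In particular, the scheme is semi-bounded (i.e. $B$ is negative semi-definite) for all $z\in(0,1)$ at least in the following two special cases: (i) $\sigma=0$ and $\tau=-(1-z^2)/12$; (ii) $\sigma=z(1-z^2)/6$ and $\tau=-\sigma/2$.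
   Context: Difference operators: $D\Phi_j:=\Phi_j-\Phi_{j-1}$, $D_0\Phi_j:=\frac12(\Phi_{j+1}-\Phi_{j-1})$, $\Delta\Phi_j:=\Phi_{j-1}-2\Phi_j+\Phi_{j+1}$, and their compositions $D^2$, $D\Delta$, $D_0\Delta$, $\Delta^2$; $I$ is the identity. Sequences are real valued. Inner product (with $h_0=\frac12$): $(\boldsymbol{\Phi},\boldsymbol{\Psi})_H:=\sum_{j\le -1}\Phi_j\Psi_j+h_0\Phi_0\Psi_0$ for sequences indexed by $j\le0$. With $a_1:=\frac{z^2(z^2-1)}{4}+2z\sigma+2\tau$, $a_2:=-\frac{z\sigma}{4}+\frac{\sigma^2}{2}-\frac{z^2\tau}{2}$, $a_3:=-\frac{\sigma^2}{4}+\tau^2$, set $$T_j:=X_j^TQX_j,\quad X_j:=\begin{pmatrix}\Phi_j\\ D\Phi_{j+1}\\ \Delta\Phi_j\\ D\Delta\Phi_{j+1}\end{pmatrix},$$ $$Q:=\begin{pmatrix}-z&-\frac{z(1-z)}{2}&\sigma&\frac{\sigma}{2}+\tau\\ -\frac{z(1-z)}{2}&\frac{z^2(1-z)}{2}-\sigma&\frac{\sigma}{2}-z\sigma-\tau&-z\left(\frac{\sigma}{2}+\tau\right)\\ \sigma&\frac{\sigma}{2}-z\sigma-\tau&\frac{z^2\sigma}{2}+z\tau&\frac{z(1+z)}{2}\left(\frac{\sigma}{2}+\tau\right)-\frac{a_1}{3}\\ \frac{\sigma}{2}+\tau&-z\left(\frac{\sigma}{2}+\tau\right)&\frac{z(1+z)}{2}\left(\frac{\sigma}{2}+\tau\right)-\frac{a_1}{3}&\frac{z\sigma}{4}+\frac{z^2\tau}{2}+\sigma\tau-\frac{a_1}{3}\end{pmatrix},$$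 $$S_j:=Y_j^TMY_j,\quad Y_j:=\begin{pmatrix}\Delta\Phi_{j-1}\\ \Delta\Phi_j\\ \Delta\Phi_{j+1}\end{pmatrix},\quad M:=\frac{a_1}{3}\begin{pmatrix}1&0&0\\0&1&0\\0&0&1\end{pmatrix}+a_2\begin{pmatrix}1&-1&0\\-1&2&-1\\0&-1&1\end{pmatrix}+a_3\begin{pmatrix}1&-2&1\\-2&4&-2\\1&-2&1\end{pmatrix}.$$ Semi-boundedness: together with extrapolation conditions defining the ghost values $\Phi_1,\Phi_2$ from $(\Phi_j)_{j\le 0}$, $A(z)$ is called semi-bounded with respect to $(\cdot,\cdot)_H$ if, for the given $z\ge0$: (1) the scheme is contractive, i.e. for every real sequence $(\Phi_j)_{j\in\mathbb{Z}}$, with $\Psi_j=A(z)\Phi_j$, one has $\Psi_j^2=\Phi_j^2+T_j-T_{j-1}+S_j$ and $S_j\le0$ for all $j$; and (2) for every sequence $(\Phi_j)_{j\le0}$ extended by the extrapolation conditions, $E:=(1-h_0)T_{-1}+h_0T_0+h_0S_0\le0$. *)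

(* Defs.v *)
From HB Require Import structures.
From mathcomp Require Import all_boot all_order all_algebra.
From mathcomp Require Import reals.

Set Implicit Arguments.
Unset Strict Implicit.
Unset Printing Implicit Defensive.

Import Order.TTheory GRing.Theory Num.Theory.
Local Open Scope ring_scope.

Section Matrices.
Context {R : realType}.

Definition mx_of_rows m n (s : seq (seq R)) : 'M[R]_(m, n) :=
  \matrix_(i < m, j < n) nth 0 (nth [::] s i) j.

Definition cV_of_seq n (s : seq R) : 'cV[R]_n := \col_(i < n) nth 0 s i.

Definition qform n (M : 'M[R]_n) (X : 'cV[R]_n) : R :=
  (X^T *m M *m X) ord0 ord0.

Definition neg_semidefinite n (M : 'M[R]_n) : Prop :=
  M^T = M /\ forall X : 'cV[R]_n, qform M X <= 0.

End Matrices.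

Section Scheme.
Context {R : realType}.
Implicit Types (Phi : int -> R) (j : int) (z sigma tau : R).

Definition D Phi : int -> R := fun j => Phi j - Phi (j - 1).

Definition D0 Phi : int -> R := fun j => (Phi (j + 1) - Phi (j - 1)) / 2.

Definition Lap Phi : int -> R :=
  fun j => Phi (j - 1) - 2 * Phi j + Phi (j + 1).

Definition A z sigma tau Phi : int -> R := fun j =>
  Phi j - z * D0 Phi j + z ^+ 2 / 2 * Lap Phi j
  + sigma * D0 (Lap Phi) j + tau * Lap (Lap Phi) j.

Definition a1 z sigma tau : R :=
  z ^+ 2 * (z ^+ 2 - 1) / 4 + 2 * z * sigma + 2 * tau.

Definition a2 z sigma tau : R :=
  - (z * sigma / 4) + sigma ^+ 2 / 2 - z ^+ 2 * tau / 2.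

Definition a3 sigma tau : R := - (sigma ^+ 2 / 4) + tau ^+ 2.

Definition Q z sigma tau : 'M[R]_4 :=
  let a := a1 z sigma tau in
  mx_of_rows 4 4
   [:: [:: - z;
           - (z * (1 - z) / 2);
           sigma;
           sigma / 2 + tau];
       [:: - (z * (1 - z) / 2);
           z ^+ 2 * (1 - z) / 2 - sigma;
           sigma / 2 - z * sigma - tau;
           - (z * (sigma / 2 + tau))];
       [:: sigma;
           sigma / 2 - z * sigma - tau;
           z ^+ 2 * sigma / 2 + z * tau;
           z * (1 + z) / 2 * (sigma / 2 + tau) - a / 3];
       [:: sigma / 2 + tau;
           - (z * (sigma / 2 + tau));
           z * (1 + z) / 2 * (sigma / 2 + tau) - a / 3;
           z * sigma / 4 + z ^+ 2 * tau / 2 + sigma * tau - a / 3]].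

Definition M z sigma tau : 'M[R]_3 :=
  (a1 z sigma tau / 3) *: 1%:M
  + a2 z sigma tau *: mx_of_rows 3 3 [:: [:: 1; -1; 0];
                                         [:: -1; 2; -1];
                                         [:: 0; -1; 1]]
  + a3 sigma tau *: mx_of_rows 3 3 [:: [:: 1; -2; 1];
                                       [:: -2; 4; -2];
                                       [:: 1; -2; 1]].

Definition T z sigma tau Phi j : R :=
  qform (Q z sigma tau)
    (cV_of_seq 4 [:: Phi j; D Phi (j + 1); Lap Phi j; D (Lap Phi) (j + 1)]).

Definition S z sigma tau Phi j : R :=
  qform (M z sigma tau)
    (cV_of_seq 3 [:: Lap Phi (j - 1); Lap Phi j; Lap Phi (j + 1)]).

Definition contractive z sigma tau : Prop :=
  forall Phi j,
    A z sigma tau Phi j ^+ 2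
      = Phi j ^+ 2 + T z sigma tau Phi j - T z sigma tau Phi (j - 1)
        + S z sigma tau Phi j
    /\ S z sigma tau Phi j <= 0.

(* [h0] is the weight of the boundary point in
   (Phi, Psi)_H = \sum_(j <= -1) Phi_j Psi_j + h0 Phi_0 Psi_0,
   and [E] is what remains of (A Phi, A Phi)_H - (Phi, Phi)_H, as computed by
   summing the contractivity identity over j <= 0, once the nonpositive terms
   S_j with j <= -1 are left out. It involves Phi_j only for j <= 2. *)
Definition E (h0 : R) z sigma tau Phi : R :=
  (1 - h0) * T z sigma tau Phi (-1) + h0 * T z sigma tau Phi 0
  + h0 * S z sigma tau Phi 0.

(* A set of extrapolation conditions is a predicate on sequences. A sequence
   (Phi_j)_(j <= 0) "extended by" the conditions is a [Phi : int -> R]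
   satisfying them; its values at j > 2 are arbitrary. *)
Definition defines_ghost_values (extrap : (int -> R) -> Prop) : Prop :=
  forall Phi, exists g1 g2 : R, forall Phi' : int -> R,
    (forall j, j <= 0 -> Phi' j = Phi j) ->
    (extrap Phi' <-> Phi' 1 = g1 /\ Phi' 2 = g2).

Definition semi_bounded (h0 : R) (extrap : (int -> R) -> Prop) z sigma tau : Prop :=
  contractive z sigma tau /\
  forall Phi, extrap Phi -> E h0 z sigma tau Phi <= 0.

Definition extrapolation2 Phi : Prop := Lap Phi 0 = 0 /\ D0 (Lap Phi) 0 = 0.

Definition B z sigma tau : 'M[R]_3 :=
  mx_of_rows 3 3
   [:: [:: - z;
           z ^+ 2 / 2;
           sigma / 2];
       [:: z ^+ 2 / 2;
           - (z ^+ 3 / 2) - sigma;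
           - (z * sigma / 2)];
       [:: sigma / 2;
           - (z * sigma / 2);
           2 * tau / 3 + sigma * tau + 5 * z * sigma / 12 - z ^+ 2 * tau / 2
           + 2 * tau ^+ 2 - z ^+ 2 * (1 - z ^+ 2) / 12]].

End Scheme.

(* Main.v *)
Require Import Defs.
From mathcomp Require Import all_boot all_order all_algebra.
From mathcomp Require Import reals.
From mathcomp Require Import ring lra.
Import Order.TTheory GRing.Theory Num.Theory.
Local Open Scope ring_scope.

(** The ghost values enter linearly, and every identity in the proposition is a
    polynomial identity in z, sigma, tau and five consecutive values of Phi;
    the mathematical content lies in the two sign conditions.

    Contractivity: the path Laplacian and the rank-one biharmonic matrix that
    make up M have common eigenvectors (1,1,1), (1,0,-1) and (1,-2,1). Hence
    the form of M is diagonal in the coordinates y0+y1+y2, y0-y2, y0-2y1+y2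
    ([qform_M]), and S is nonpositive as soon as the three coefficients
    a1/9, (a1/3+a2)/2 and a1/18+a2/2+a3 are. In both special cases each of
    them is 1-z^2 times a factor whose sign on (0,1) is evident.

    Boundary: in both cases sigma is z times some k >= 0, namely k = 0 in
    case (i) and k = (1-z^2)/6 in case (ii). Completing squares first in p and
    then in d splits the form of B at (p,d,r) into
    -z (p - z d/2 - k r/2)^2 - (z^3/4) d^2 - z k (d + z r/4)^2 + c r^2
    ([qform_B_sos]), so that only the sign of the scalar c remains. Since E is
    the form of B on extrapolated sequences, this settles both the negative
    semi-definiteness of B and the second half of semi-boundedness. *)

(** * Quadratic forms in small dimensions *)

Section QuadraticForms.
Context {R : realType}.

Lemma addr_le0 (x y : R) : x <= 0 -> y <= 0 -> x + y <= 0.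
Proof. by move=> x0 y0; rewrite -(addr0 0) lerD. Qed.

Lemma qformE n (P : 'M[R]_n) (X : 'cV[R]_n) :
  qform P X = \sum_i \sum_j X i ord0 * P i j * X j ord0.
Proof.
rewrite /qform mxE exchange_big /=; apply: eq_bigr => j _.
by rewrite mxE mulr_suml; apply: eq_bigr => i _; rewrite mxE.
Qed.

Lemma cV_of_seq_surj3 (X : 'cV[R]_3) :
  exists p d r, X = cV_of_seq 3 [:: p; d; r].
Proof.
exists (X 0 0), (X 1 0), (X 2%:R 0); apply/matrixP => i j.
rewrite ord1 mxE; case: i => -[|[|[|//]]] lti /=;
  by congr (X _ _); apply/val_inj.
Qed.

(** Diagonalization in the common eigenvectors (1,1,1), (1,0,-1), (1,-2,1): the
    path Laplacian has eigenvalues 0, 1, 3 on them, the biharmonic matrix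
    0, 0, 6, and the divisors 3, 2, 6 are their squared norms. *)
Lemma qform_M (z sigma tau y0 y1 y2 : R) :
  qform (M z sigma tau) (cV_of_seq 3 [:: y0; y1; y2]) =
    a1 z sigma tau / 9 * (y0 + y1 + y2) ^+ 2
  + (a1 z sigma tau / 3 + a2 z sigma tau) / 2 * (y0 - y2) ^+ 2
  + (a1 z sigma tau / 18 + a2 z sigma tau / 2 + a3 sigma tau)
    * (y0 - 2 * y1 + y2) ^+ 2.
Proof.
rewrite qformE !big_ord_recl !big_ord0 /M !mxE /=.
by field.
Qed.

Lemma qform_Q (z sigma tau x0 x1 x2 x3 : R) :
  qform (Q z sigma tau) (cV_of_seq 4 [:: x0; x1; x2; x3]) =
    - z * x0 ^+ 2 - z * (1 - z) * x0 * x1 + 2 * sigma * x0 * x2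
  + (sigma + 2 * tau) * x0 * x3
  + (z ^+ 2 * (1 - z) / 2 - sigma) * x1 ^+ 2
  + (sigma - 2 * z * sigma - 2 * tau) * x1 * x2
  - z * (sigma + 2 * tau) * x1 * x3
  + (z ^+ 2 * sigma / 2 + z * tau) * x2 ^+ 2
  + (z * (1 + z) * (sigma / 2 + tau) - 2 * a1 z sigma tau / 3) * x2 * x3
  + (z * sigma / 4 + z ^+ 2 * tau / 2 + sigma * tau - a1 z sigma tau / 3)
    * x3 ^+ 2.
Proof.
rewrite qformE !big_ord_recl !big_ord0 /Q !mxE /=.
by field.
Qed.

Lemma qform_B (z sigma tau p d r : R) :
  qform (B z sigma tau) (cV_of_seq 3 [:: p; d; r]) =
    - z * p ^+ 2 + z ^+ 2 * p * d + sigma * p * r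
  - (z ^+ 3 / 2 + sigma) * d ^+ 2 - z * sigma * d * r
  + (2 * tau / 3 + sigma * tau + 5 * z * sigma / 12 - z ^+ 2 * tau / 2
     + 2 * tau ^+ 2 - z ^+ 2 * (1 - z ^+ 2) / 12) * r ^+ 2.
Proof.
rewrite qformE !big_ord_recl !big_ord0 /B !mxE /=.
by field.
Qed.

End QuadraticForms.

(** * Contractivity *)

Section Contractivity.
Context {R : realType}.

(** Polynomial identity in the five values Phi (j-2), ..., Phi (j+2). It holds
    for all parameters: a restriction on them arises only from the sign
    of S. *)
Lemma energy_identity (z sigma tau : R) (Phi : int -> R) j :
  A z sigma tau Phi j ^+ 2
  = Phi j ^+ 2 + T z sigma tau Phi j - T z sigma tau Phi (j - 1)
    + S z sigma tau Phi j.
Proof.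
rewrite /T /S !qform_Q qform_M /A /D /D0 /Lap !subrK !addrK.
(* All indices are now j-1-1, j-1, j, j+1 or j+1+1, which are made atoms. *)
move: (Phi (j - 1 - 1)) (Phi (j - 1)) (Phi j) (Phi (j + 1)) (Phi (j + 1 + 1)).
by move=> u0 u1 u2 u3 u4; rewrite /a1 /a2 /a3; field.
Qed.

Lemma contractive_of_coef_le0 (z sigma tau : R) :
  a1 z sigma tau <= 0 ->
  a1 z sigma tau / 3 + a2 z sigma tau <= 0 ->
  a1 z sigma tau / 18 + a2 z sigma tau / 2 + a3 sigma tau <= 0 ->
  contractive z sigma tau.
Proof.
move=> c0 c1 c2 Phi j; split; first exact: energy_identity.
rewrite /S qform_M; set s := _ ^+ 2; set d := _ ^+ 2; set w := _ ^+ 2.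
have [s0 d0 w0] : [/\ 0 <= s, 0 <= d & 0 <= w] by rewrite !sqr_ge0.
by rewrite !addr_le0 // mulr_le0_ge0 //; lra.
Qed.

End Contractivity.

(** * The boundary term *)

Section Boundary.
Context {R : realType}.

(** The second condition says that Lap Phi takes the same value at 1 and at -1;
    with the first one the system for the ghost values is triangular. *)
Lemma extrapolation2E (Phi : int -> R) :
  extrapolation2 Phi <->
  Phi 1 = 2 * Phi 0 - Phi (-1) /\
  Phi 2 = 4 * Phi 0 - 4 * Phi (-1) + Phi (-2).
Proof.
rewrite /extrapolation2 /D0 /Lap sub0r add0r addNr subrr.
have -> : 1 + 1 = 2 :> int by [].
have -> : - 1 - 1 = - 2 :> int by [].
by split=> -[e1 e2]; split; lra.
Qed.

Lemma extrapolation2_ghost : defines_ghost_values (@extrapolation2 R).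
Proof.
move=> Phi.
exists (2 * Phi 0 - Phi (-1)), (4 * Phi 0 - 4 * Phi (-1) + Phi (-2)).
by move=> Phi' eqPhi; rewrite extrapolation2E (eqPhi 0) ?(eqPhi (-1)) ?(eqPhi (-2)).
Qed.

Lemma E_qform_B (z sigma tau : R) (Phi : int -> R) :
  extrapolation2 Phi ->
  E (1 / 2) z sigma tau Phi
  = qform (B z sigma tau) (cV_of_seq 3 [:: Phi 0; D Phi 0; D (D Phi) 0]).
Proof.
move=> /extrapolation2E[ghost1 ghost2].
rewrite /E /T /S !qform_Q qform_M qform_B /D /Lap.
rewrite !(add0r, addNr, subrr).
have -> : 1 + 1 = 2 :> int by [].
have -> : - 1 - 1 = - 2 :> int by [].
rewrite ghost1 ghost2 /a1 /a2 /a3.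
by field.
Qed.

(** Successive completion of squares, in p and then in d. Eliminating p
    divides sigma by z; the parametrization sigma = z * k keeps the squares
    polynomial. *)
Lemma qform_B_sos (z k tau p d r : R) :
  qform (B z (z * k) tau) (cV_of_seq 3 [:: p; d; r]) =
  - (z * (p - z * d / 2 - k * r / 2) ^+ 2
     + (z ^+ 3 / 4 * d ^+ 2 + z * k * (d + z * r / 4) ^+ 2))
  + (2 * tau / 3 + z * k * tau + 5 * z ^+ 2 * k / 12 - z ^+ 2 * tau / 2
     + 2 * tau ^+ 2 - z ^+ 2 * (1 - z ^+ 2) / 12
     + z * k ^+ 2 / 4 + z ^+ 3 * k / 16) * r ^+ 2.
Proof. by rewrite qform_B; field. Qed.

Lemma B_neg_semidefinite (z k tau : R) :
  0 <= z -> 0 <= k ->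
  2 * tau / 3 + z * k * tau + 5 * z ^+ 2 * k / 12 - z ^+ 2 * tau / 2
  + 2 * tau ^+ 2 - z ^+ 2 * (1 - z ^+ 2) / 12
  + z * k ^+ 2 / 4 + z ^+ 3 * k / 16 <= 0 ->
  neg_semidefinite (B z (z * k) tau).
Proof.
move=> z0 k0 c0; split.
  by apply/matrixP => -[[|[|[|//]]] ?] -[[|[|[|//]]] ?]; rewrite !mxE.
move=> X; have [p [d [r ->]]] := cV_of_seq_surj3 X.
rewrite qform_B_sos; apply: addr_le0.
  rewrite oppr_le0 !addr_ge0 //.
  - by rewrite mulr_ge0 ?sqr_ge0.
  - by rewrite mulr_ge0 ?sqr_ge0 ?divr_ge0 ?exprn_ge0.
  - by rewrite mulr_ge0 ?sqr_ge0 ?mulr_ge0.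
by apply: mulr_le0_ge0; [exact: c0 | exact: sqr_ge0].
Qed.

Lemma semi_bounded_of_B (z sigma tau : R) :
  contractive z sigma tau -> neg_semidefinite (B z sigma tau) ->
  semi_bounded (1 / 2) (@extrapolation2 R) z sigma tau.
Proof.
by move=> ctr [_ Ble0]; split=> // Phi /E_qform_B ->; apply: Ble0.
Qed.

End Boundary.

(** * The two special cases *)

Section SpecialCases.
Context {R : realType}.
Implicit Type z : R.

Lemma contractive_case1 z :
  0 < z < 1 -> contractive z 0 (- ((1 - z ^+ 2) / 12)).
Proof.
move=> /andP[z0 z1]; have q1 : 0 <= 1 - z ^+ 2 by nra.
have q0 := sqr_ge0 z.
apply: contractive_of_coef_le0; rewrite /a1 /a2 /a3.
- rewrite [leLHS](_ : _ = - ((1 - z ^+ 2) * (3 * z ^+ 2 + 2) / 12));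
    last by field.
  by nra.
- rewrite [leLHS](_ : _ = - ((1 - z ^+ 2) * (3 * z ^+ 2 + 4) / 72));
    last by field.
  by nra.
- rewrite [leLHS](_ : _ = - ((1 - z ^+ 2) / 432)); last by field.
  by lra.
Qed.

Lemma contractive_case2 z (k := (1 - z ^+ 2) / 6) :
  0 < z < 1 -> contractive z (z * k) (- (z * k / 2)).
Proof.
move=> /andP[z0 z1].
have w0 : 0 <= z * (1 - z ^+ 2) by apply: mulr_ge0; nra.
have v0 : 0 <= (1 - z) * (2 - z) by apply: mulr_ge0; lra.
(* a1/3 and a2 are nonpositive separately, and a3 vanishes. *)
have c1 : a1 z (z * k) (- (z * k / 2)) <= 0.
  rewrite [leLHS](_ : _ = - (z * (1 - z ^+ 2) * (2 - z) / 12));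
    last by rewrite /a1 /k; field.
  by nra.
have c2 : a2 z (z * k) (- (z * k / 2)) <= 0.
  rewrite [leLHS](_ : _ = - (z * (z * (1 - z ^+ 2) * ((1 - z) * (2 - z))) / 72));
    last by rewrite /a2 /k; field.
  by rewrite oppr_le0 divr_ge0 // (mulr_ge0 (ltW z0)) // mulr_ge0.
have c3 : a3 (z * k) (- (z * k / 2)) = 0 by rewrite /a3; field.
by apply: contractive_of_coef_le0; rewrite ?c3; lra.
Qed.

Lemma B_neg_semidefinite_case1 z :
  0 < z < 1 -> neg_semidefinite (B z 0 (- ((1 - z ^+ 2) / 12))).
Proof.
move=> /andP[z0 z1].
rewrite -(mulr0 z); apply: B_neg_semidefinite; [exact: ltW | by [] |].
have q1 : 0 <= 1 - z ^+ 2 by nra.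
have q0 := sqr_ge0 z.
rewrite [leLHS](_ : _ = - ((1 - z ^+ 2) * (4 * z ^+ 2 + 3) / 72));
  last by field.
by nra.
Qed.

Lemma B_neg_semidefinite_case2 z (k := (1 - z ^+ 2) / 6) :
  0 < z < 1 -> neg_semidefinite (B z (z * k) (- (z * k / 2))).
Proof.
move=> /andP[z0 z1].
have k0 : 0 <= k by rewrite /k; nra.
apply: B_neg_semidefinite; [exact: ltW | exact: k0 |].
rewrite [leLHS](_ : _ = - (z * k * (14 + 4 * z - 13 * z ^+ 2) / 48));
  last by rewrite /k; field.
(* Since z^2 <= 1, the quadratic factor is at least 1 + 4 z. *)
by rewrite oppr_le0 divr_ge0 // !mulr_ge0 ?(ltW z0) //; nra.
Qed.

End SpecialCases.

Theorem proposition1 (R : realType) (z sigma tau : R) :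
  defines_ghost_values (@extrapolation2 R)
  /\ (forall Phi : int -> R, extrapolation2 Phi ->
        E (1 / 2) z sigma tau Phi
        = qform (B z sigma tau)
            (cV_of_seq 3 [:: Phi 0; D Phi 0; D (D Phi) 0]))
  /\ (0 < z < 1 ->
      (sigma = 0 /\ tau = - ((1 - z ^+ 2) / 12))
      \/ (sigma = z * (1 - z ^+ 2) / 6 /\ tau = - (sigma / 2)) ->
      semi_bounded (1 / 2) (@extrapolation2 R) z sigma tau
      /\ neg_semidefinite (B z sigma tau)).
Proof.
split; first exact: extrapolation2_ghost.
split; first exact: E_qform_B.
move=> z01 cases.
suff [ctr Bneg] : contractive z sigma tau /\ neg_semidefinite (B z sigma tau).
  by split=> //; apply: semi_bounded_of_B.
case: cases => -[-> ->].
  by split; [exact: contractive_case1 | exact: B_neg_semidefinite_case1].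
rewrite -mulrA.
by split; [exact: contractive_case2 | exact: B_neg_semidefinite_case2].
Qed.
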